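(* Let $As_3^2$ be the three-dimensional complex associative algebra with basis $\{e_1,e_2,e_3\}$ and non-zero products $e_1e_2=e_3$, $e_2e_1=-e_3$. Any three-dimensional complex anti-dendriform algebra associated to the algebra $As_3^2$ is isomorphic to one of the following pairwise non-isomorphic algebras (with basis $\{e_1,e_2,e_3\}$, omitted products being zero): $AD_3^8(\alpha,\beta):\ e_1\vartriangleright e_1=e_3,\ e_1\vartriangleright e_2=\alpha e_3,\ e_2\vartriangleright e_1=\beta e_3,\ e_1\vartriangleleft e_1=-e_3,\ e_1\vartriangleleft e_2=(1-\alpha)e_3,\ e_2\vartriangleleft e_1=(-1-\beta)e_3;$ $AD_3^9(\alpha):\ e_1\vartriangleright e_2=\alpha e_3,\ e_2\vartriangleright e_1=-\alpha e_3,\ e_1\vartriangleleft e_2=(1-\alpha)e_3,\ e_2\vartriangleleft e_1=(-1+\alpha)e_3;$ $AD_3^{10}:\ e_1\vartriangleright e_1=e_2,\ e_2\vartriangleright e_1=-e_3,\ e_1\vartriangleleft e_1=-e_2,\ e_1\vartriangleleft e_2=e_3;$ where $\alpha,\beta\in\mathbb{C}$ and $AD_3^8(\alpha,\beta)\cong AD_3^8(-\beta,-\alpha)$ (so the asserted pairwise non-isomorphism is understood apart from this isomorphism).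
   Context: An anti-dendriform algebra is a vector space $A$ with two bilinear operations $\vartriangleright,\vartriangleleft: A\otimes A\to A$ such that, writing $x\cdot y=x\vartriangleright y+x\vartriangleleft y$, for all $x,y,z\in A$: $x\vartriangleright(y\vartriangleright z)=-(x\cdot y)\vartriangleright z=-x\vartriangleleft(y\cdot z)=(x\vartriangleleft y)\vartriangleleft z$ and $(x\vartriangleright y)\vartriangleleft z=x\vartriangleright(y\vartriangleleft z)$. Then $(A,\cdot)$ is an associative algebra, called the associated associative algebra of $(A,\vartriangleright,\vartriangleleft)$. An anti-dendriform algebra is associated to an associative algebra $B$ if its associated associative algebra is (isomorphic to) $B$. Isomorphisms of anti-dendriform algebras are linear bijections preserving both operations $\vartriangleright$ and $\vartriangleleft$. *)

(* Defs.v *)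
From HB Require Import structures.
From mathcomp Require Import all_boot all_order all_algebra.
From mathcomp Require Export complex reals.

Set Implicit Arguments.
Unset Strict Implicit.
Unset Printing Implicit Defensive.

Import GRing.Theory.

Local Open Scope ring_scope.

(* A vector space with two bilinear operations; the anti-dendriform identities
   are the separate predicate [is_antidendriform]. *)
Record two_products (K : fieldType) (A : lmodType K) := TwoProducts {
  rprod : {bilinear A -> A -> A};  (* x ▷ y *)
  lprod : {bilinear A -> A -> A}   (* x ◁ y *)
}.

Definition assoc_prod (K : fieldType) (A : lmodType K) (D : two_products A)
  (x y : A) : A := rprod D x y + lprod D x y.

Record is_antidendriform (K : fieldType) (A : lmodType K)
    (D : two_products A) : Prop := IsAntidendriform {
  ad_rr_Mr : forall x y z,
    rprod D x (rprod D y z) = - rprod D (assoc_prod D x y) z;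
  ad_Mr_lM : forall x y z,
    - rprod D (assoc_prod D x y) z = - lprod D x (assoc_prod D y z);
  ad_lM_ll : forall x y z,
    - lprod D x (assoc_prod D y z) = lprod D (lprod D x y) z;
  ad_rl : forall x y z,
    lprod D (rprod D x y) z = rprod D x (lprod D y z)
}.

Lemma assoc_prodA (K : fieldType) (A : lmodType K) (D : two_products A) :
  is_antidendriform D -> associative (assoc_prod D).
Proof.
case=> rr_Mr Mr_lM lM_ll rl x y z; rewrite /assoc_prod.
rewrite [rprod D x (_ + _)]linearDr [lprod D (_ + _) z]linearDl.
have r0 : rprod D (rprod D x y + lprod D x y) z = - rprod D x (rprod D y z).
  by rewrite rr_Mr opprK.
have l0 : lprod D x (rprod D y z + lprod D y z) = - rprod D x (rprod D y z).
  by rewrite rr_Mr Mr_lM !opprK.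
have ll : lprod D (lprod D x y) z = rprod D x (rprod D y z).
  by rewrite -lM_ll -Mr_lM -rr_Mr.
by rewrite r0 l0 ll rl [in LHS](addrC (rprod D x _)) addrK addrCA addNr addr0.
Qed.

Definition ad_iso (K : fieldType) (A B : lmodType K)
    (D : two_products A) (E : two_products B) : Prop :=
  exists f : {linear A -> B},
    [/\ bijective f,
        forall x y, f (rprod D x y) = rprod E (f x) (f y)
      & forall x y, f (lprod D x y) = lprod E (f x) (f y)].

(* The algebra (A, ·) of D is isomorphic to the algebra (B, mulB). *)
Definition associated_to (K : fieldType) (A B : lmodType K)
    (D : two_products A) (mulB : {bilinear B -> B -> B}) : Prop :=
  exists f : {linear A -> B},
    bijective f /\ forall x y, f (assoc_prod D x y) = mulB (f x) (f y).

(* e_ 1, e_ 2, e_ 3 is the standard basis of K^3. *)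
Definition e_ (K : fieldType) (k : nat) : 'rV[K]_3 :=
  delta_mx 0 (inord k.-1).
Arguments e_ {K} k.

(* The bilinear product on K^3 with e_i * e_j = t i j for 1 <= i, j <= 3; row
   vectors are indexed from 0, hence the successors. *)
Definition table_mul (K : fieldType) (t : nat -> nat -> 'rV[K]_3)
    (u v : 'rV[K]_3) : 'rV[K]_3 :=
  \sum_(i < 3) \sum_(j < 3) (u 0 i * v 0 j) *: t i.+1 j.+1.

Lemma table_mul_is_bilinear (K : fieldType) (t : nat -> nat -> 'rV[K]_3) :
  bilinear_for *:%R *:%R (table_mul t).
Proof.
split=> [v c u w|u c v w]; rewrite /table_mul /= scaler_sumr -big_split /=;
  apply: eq_bigr => i _; rewrite scaler_sumr -big_split /=;
  apply: eq_bigr => j _; rewrite !mxE scalerA -scalerDl.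
- by rewrite mulrDl mulrA.
- by rewrite mulrDr mulrCA.
Qed.

HB.instance Definition _ (K : fieldType) (t : nat -> nat -> 'rV[K]_3) :=
  bilinear_isBilinear.Build K 'rV[K]_3 'rV[K]_3 'rV[K]_3 *:%R *:%R
    (table_mul t) (table_mul_is_bilinear t).

Definition As32 (K : fieldType) : {bilinear 'rV[K]_3 -> 'rV[K]_3 -> 'rV[K]_3} :=
  table_mul (fun i j => match i, j with
    | 1%N, 2%N => e_ 3
    | 2%N, 1%N => - e_ 3
    | _, _ => 0
    end).

Lemma As32E (K : fieldType) (u v : 'rV[K]_3) :
  As32 K u v =
    (u 0 (inord 0) * v 0 (inord 1) - u 0 (inord 1) * v 0 (inord 0)) *: e_ 3.
Proof.
have inordE (i : 'I_3) (k : nat) : i = k :> nat -> i = inord k.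
  by move=> <-; rewrite inord_val.
rewrite /= /table_mul !big_ord_recl !big_ord0 /= !scaler0 !addr0 !add0r.
rewrite scalerN -scalerBl.
by congr ((_ * _ - _ * _) *: _); congr (_ _ _); apply: inordE.
Qed.

Lemma As32A (K : fieldType) : associative (As32 K).
Proof.
have e3 (c : K) k : (k < 2)%N -> (c *: e_ 3) 0 (inord k) = 0.
  move=> k2; rewrite !mxE eqxx -val_eqE /= !inordK ?ltnS ?(ltnW k2) //=.
  by case: k k2 => [|[|k]] // _; rewrite mulr0.
by move=> x y z; rewrite !As32E !e3 // !(mulr0, mul0r) !subrr !scale0r.
Qed.

Definition AD8 (K : fieldType) (alpha beta : K) : two_products 'rV[K]_3 :=
  TwoProducts
    (table_mul (fun i j => match i, j with
      | 1%N, 1%N => e_ 3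
      | 1%N, 2%N => alpha *: e_ 3
      | 2%N, 1%N => beta *: e_ 3
      | _, _ => 0
      end))
    (table_mul (fun i j => match i, j with
      | 1%N, 1%N => - e_ 3
      | 1%N, 2%N => (1 - alpha) *: e_ 3
      | 2%N, 1%N => (- 1 - beta) *: e_ 3
      | _, _ => 0
      end)).

Definition AD9 (K : fieldType) (alpha : K) : two_products 'rV[K]_3 :=
  TwoProducts
    (table_mul (fun i j => match i, j with
      | 1%N, 2%N => alpha *: e_ 3
      | 2%N, 1%N => - alpha *: e_ 3
      | _, _ => 0
      end))
    (table_mul (fun i j => match i, j with
      | 1%N, 2%N => (1 - alpha) *: e_ 3
      | 2%N, 1%N => (- 1 + alpha) *: e_ 3
      | _, _ => 0
      end)).

Definition AD10 (K : fieldType) : two_products 'rV[K]_3 :=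
  TwoProducts
    (table_mul (fun i j => match i, j with
      | 1%N, 1%N => e_ 2
      | 2%N, 1%N => - e_ 3
      | _, _ => 0
      end))
    (table_mul (fun i j => match i, j with
      | 1%N, 1%N => - e_ 2
      | 1%N, 2%N => e_ 3
      | _, _ => 0
      end)).

(* Main.v *)
Require Import Defs.
From HB Require Import structures.
From mathcomp Require Import all_boot all_order all_algebra.
From mathcomp Require Import complex reals boolp ring.

Set Implicit Arguments.
Unset Strict Implicit.
Unset Printing Implicit Defensive.

Import GRing.Theory.

Local Open Scope ring_scope.

(** An anti-dendriform structure associated to As32 may be transported to K^3
    so that its associated product is As32 itself: x . y = (x /\ y) e_3, where
    x /\ y is the determinant of the first two coordinates
    ([associated_to_transport]).  The product x |> y then determines the
    structure, since x <| y = x . y - x |> y.  Because e_3 annihilates ( . ) and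
    x /\ x = 0, the anti-dendriform identities force e_3 to annihilate |> as
    well, and then they amount to x |> (y |> z) = 0 and
    (x |> y) |> z = (x |> y) . z ([antidendriform_As32P]).

    A change of basis compatible with As32 is given by any two vectors b1, b2
    with b1 /\ b2 != 0, the third one being b1 . b2; so an isomorphism with a
    listed algebra is a pair b1, b2 on which |> follows its table
    ([frame_iso]).

    - If v, v |> v are independent modulo e_3 for some v, they are such a pair
      for AD10 ([iso_AD10]).
    - Otherwise all the products x |> y lie on the line of e_3
      ([wedge_square_neq0], [rprod_line]), so |> is a bilinear form on the
      plane K^3 / e_3.  If it is alternating it is a multiple of the
      determinant, which is AD9 ([iso_AD9]).  If not, take v with v |> v != 0;
      over an algebraically closed field the form has an isotropic vector
      outside the line of v, and the two form a pair for AD8 ([iso_AD8]).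

    The algebras are told apart by squares and cubes for |>: all squares vanish
    in AD9 only, and (e_1 |> e_1) |> e_1 is nonzero in AD10, whereas triple
    products vanish in AD8.  Inside a family, a change of basis acts on e_3 by
    the determinant of its action on the plane.  Hence for AD9 the ratio alpha
    of |> to ( . ) is invariant, and for AD8 so are alpha - beta, the
    antisymmetric part of the form, and alpha * beta, minus its
    determinant; these two determine (alpha, beta) up to the stated exchange
    ([AD8_iso_params], [AD8_swap]). *)

(** * Isomorphisms of anti-dendriform structures *)

Section Isomorphisms.

Variable K : fieldType.

Lemma linear_bij_inv (A B : lmodType K) (f : {linear A -> B}) :
  bijective f -> exists g : {linear B -> A}, cancel f g /\ cancel g f.
Proof.
case=> g fK gK; have g_lin := can2_linear fK gK.
pose G := GRing.isLinear.Build K B A *:%R g g_lin.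
pose gL : {linear B -> A} := HB.pack g G.
by exists gL.
Qed.

Lemma ad_iso_sym (A B : lmodType K) (D : two_products A) (E : two_products B) :
  ad_iso D E -> ad_iso E D.
Proof.
case=> f [f_bij f_r f_l]; have [g [fK gK]] := linear_bij_inv f_bij.
exists g; split=> [|x y|x y]; first by exists f.
  by rewrite -[RHS]fK f_r !gK.
by rewrite -[RHS]fK f_l !gK.
Qed.

Lemma ad_iso_trans (A B C : lmodType K) (D : two_products A)
    (E : two_products B) (F : two_products C) :
  ad_iso D E -> ad_iso E F -> ad_iso D F.
Proof.
case=> f [f_bij f_r f_l] [g [g_bij g_r g_l]].
exists (g \o f); split=> [|x y|x y]; first exact: bij_comp.
  by rewrite /= f_r g_r.
by rewrite /= f_l g_l.
Qed.

Lemma ad_iso_assoc (A B : lmodType K) (D : two_products A)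
    (E : two_products B) (f : {linear A -> B}) :
    (forall x y, f (rprod D x y) = rprod E (f x) (f y)) ->
    (forall x y, f (lprod D x y) = lprod E (f x) (f y)) ->
  forall x y, f (assoc_prod D x y) = assoc_prod E (f x) (f y).
Proof. by move=> f_r f_l x y; rewrite /assoc_prod linearD f_r f_l. Qed.

Lemma ad_iso_antidendriform (A B : lmodType K) (D : two_products A)
    (E : two_products B) :
  ad_iso D E -> is_antidendriform D -> is_antidendriform E.
Proof.
move/ad_iso_sym=> [f [/bij_inj f_inj f_r f_l]] [rr_Mr Mr_lM lM_ll rl].
have f_m := ad_iso_assoc f_r f_l.
split=> x y z; apply: f_inj; rewrite ?linearN ?(f_r, f_l, f_m) //.
Qed.

(** Each of the two operations is the associated product minus the other, so
    one of them and the associated product carry all the structure. *)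
Lemma ad_iso_of_assoc (A B : lmodType K) (D : two_products A)
    (E : two_products B) (f : {linear A -> B}) :
    bijective f ->
    (forall x y, f (rprod D x y) = rprod E (f x) (f y)) ->
    (forall x y, f (assoc_prod D x y) = assoc_prod E (f x) (f y)) ->
  ad_iso D E.
Proof.
move=> f_bij f_r f_m; exists f; split=> // x y.
by have := f_m x y; rewrite /assoc_prod linearD f_r => /addrI.
Qed.

End Isomorphisms.

(** * Structure constants on K^3 *)

Section Coordinates.

Variable K : fieldType.
Implicit Types (u v x y z : 'rV[K]_3) (t : nat -> nat -> 'rV[K]_3).

Lemma eq_inord (i : 'I_3) (k : nat) : i = k :> nat -> i = inord k.
Proof. by move=> <-; rewrite inord_val. Qed.

Lemma e_sum u :
  u = u 0 (inord 0) *: e_ 1 + u 0 (inord 1) *: e_ 2 + u 0 (inord 2) *: e_ 3.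
Proof.
rewrite {1}(row_sum_delta u) !big_ord_recl big_ord0 addr0 addrA.
by congr (_ *: _ + _ *: _ + _ *: _); congr (_ _ _); apply: eq_inord.
Qed.

Lemma e_coord (k j : nat) : (k < 3)%N -> (j < 3)%N ->
  (e_ k.+1 : 'rV[K]_3) 0 (inord j) = (j == k)%:R.
Proof. by move=> k3 j3; rewrite mxE eqxx /= -val_eqE /= !inordK. Qed.

Lemma coordE :
  (forall a u i, (a *: u) 0 i = a * u 0 i) *
  (forall u v i, (u + v) 0 i = u 0 i + v 0 i) *
  (forall u i, (- u) 0 i = - u 0 i).
Proof. by do 2?split; move=> *; rewrite mxE. Qed.

Lemma table_mulE t u v : table_mul t u v =
  \sum_(i < 3) \sum_(j < 3) (u 0 (inord i) * v 0 (inord j)) *: t i.+1 j.+1.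
Proof.
by apply: eq_bigr => i _; apply: eq_bigr => j _; rewrite !inord_val.
Qed.

Lemma table_mul_homo (A : lmodType K) (m : {bilinear A -> A -> A}) t
    (g : {linear 'rV[K]_3 -> A}) :
    (forall i j : 'I_3,
      g (t i.+1 j.+1) = m (g (e_ i.+1)) (g (e_ j.+1))) ->
  forall u v, g (table_mul t u v) = m (g u) (g v).
Proof.
have gE u : g u = \sum_(i < 3) u 0 i *: g (e_ i.+1).
  rewrite {1}(row_sum_delta u) linear_sum; apply: eq_bigr => i _.
  by rewrite linearZ /e_ /= inord_val.
move=> g_t u v; rewrite [g u]gE [g v]gE linear_sumlz linear_sum.
apply: eq_bigr => i _; rewrite linear_sumr linear_sum; apply: eq_bigr => j _.
by rewrite linearZ linearZl_LR linearZr_LR /= g_t scalerA.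
Qed.

(** Transport of structure along the isomorphism with (K^3, m): the new
    operations are read off from their structure constants. *)
Lemma associated_to_transport (A : lmodType K) (D : two_products A)
    (m : {bilinear 'rV[K]_3 -> 'rV[K]_3 -> 'rV[K]_3}) :
  associated_to D m ->
  exists2 E : two_products 'rV[K]_3, ad_iso D E & assoc_prod E =2 m.
Proof.
case=> f [f_bij f_m]; have [g [fK gK]] := linear_bij_inv f_bij.
pose tab (p : {bilinear A -> A -> A}) i j := f (p (g (e_ i)) (g (e_ j))).
have g_tab p u v : g (table_mul (tab p) u v) = p (g u) (g v).
  by apply: table_mul_homo => i j; rewrite fK.
pose E := TwoProducts (table_mul (tab (rprod D))) (table_mul (tab (lprod D))).
have isoED : ad_iso E D.
  by exists g; split=> *; rewrite ?g_tab //; exists f.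
exists E; first exact: ad_iso_sym.
move=> u v; apply: (can_inj gK).
by rewrite /assoc_prod linearD !g_tab -[RHS]fK -[in RHS](gK u) -[in RHS](gK v)
  -f_m !fK.
Qed.

(** The alternating form by which As32 multiplies; its radical is the line of
    e_3, so it is the determinant of the plane K^3 / e_3. *)
Definition wedge u v : K :=
  u 0 (inord 0) * v 0 (inord 1) - u 0 (inord 1) * v 0 (inord 0).

Lemma As32_wedge u v : As32 K u v = wedge u v *: e_ 3.
Proof. exact: As32E. Qed.

Lemma AD8_rprodE a b u v : rprod (AD8 a b) u v =
  (u 0 (inord 0) * v 0 (inord 0) + a * (u 0 (inord 0) * v 0 (inord 1))
   + b * (u 0 (inord 1) * v 0 (inord 0))) *: e_ 3.
Proof.
rewrite /= table_mulE !big_ord_recl !big_ord0 /=.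
by apply/rowP => j; move: (e_ 3) => e; rewrite !mxE; ring.
Qed.

Lemma AD9_rprodE a u v : rprod (AD9 a) u v = (a * wedge u v) *: e_ 3.
Proof.
rewrite /= table_mulE !big_ord_recl !big_ord0 /=.
by apply/rowP => j; move: (e_ 3) => e; rewrite /wedge !mxE; ring.
Qed.

Lemma AD10_rprodE u v : rprod (AD10 K) u v =
  (u 0 (inord 0) * v 0 (inord 0)) *: e_ 2
  - (u 0 (inord 1) * v 0 (inord 0)) *: e_ 3.
Proof.
rewrite /= table_mulE !big_ord_recl !big_ord0 /=.
by apply/rowP => j; move: (e_ 2) (e_ 3) => e e'; rewrite !mxE; ring.
Qed.

Lemma AD8_assoc a b : assoc_prod (AD8 a b) =2 As32 K.
Proof.
move=> u v; rewrite As32_wedge /assoc_prod /= !table_mulE !big_ord_recl.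
rewrite !big_ord0 /=.
by apply/rowP => j; move: (e_ 3) => e; rewrite /wedge !mxE; ring.
Qed.

Lemma AD9_assoc a : assoc_prod (AD9 a) =2 As32 K.
Proof.
move=> u v; rewrite As32_wedge /assoc_prod /= !table_mulE !big_ord_recl.
rewrite !big_ord0 /=.
by apply/rowP => j; move: (e_ 3) => e; rewrite /wedge !mxE; ring.
Qed.

Lemma AD10_assoc : assoc_prod (AD10 K) =2 As32 K.
Proof.
move=> u v; rewrite As32_wedge /assoc_prod /= !table_mulE !big_ord_recl.
rewrite !big_ord0 /=.
by apply/rowP => j; move: (e_ 2) (e_ 3) => e e'; rewrite /wedge !mxE; ring.
Qed.

End Coordinates.

(** * The determinant form of As32 *)

Section Wedge.

Variable K : fieldType.
Implicit Types u v w : 'rV[K]_3.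

Lemma wedgeDl u v w : wedge (u + v) w = wedge u w + wedge v w.
Proof. by rewrite /wedge !mxE; ring. Qed.

Lemma wedgeZl a u w : wedge (a *: u) w = a * wedge u w.
Proof. by rewrite /wedge !mxE; ring. Qed.

Lemma wedgeNl u w : wedge (- u) w = - wedge u w.
Proof. by rewrite /wedge !mxE; ring. Qed.

Lemma wedgeC u v : wedge u v = - wedge v u.
Proof. by rewrite /wedge; ring. Qed.

Lemma wedgeDr u v w : wedge w (u + v) = wedge w u + wedge w v.
Proof. by rewrite /wedge !mxE; ring. Qed.

Lemma wedgeZr a u w : wedge w (a *: u) = a * wedge w u.
Proof. by rewrite /wedge !mxE; ring. Qed.

Lemma wedgevv u : wedge u u = 0.
Proof. by rewrite /wedge; ring. Qed.

Lemma wedge_e3l u : wedge (e_ 3) u = 0.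
Proof. by rewrite /wedge !e_coord //= !mul0r subrr. Qed.

Lemma wedge_e3r u : wedge u (e_ 3) = 0.
Proof. by rewrite wedgeC wedge_e3l oppr0. Qed.

Lemma wedge_e1e2 : wedge (e_ 1) (e_ 2) = 1 :> K.
Proof. by rewrite /wedge !e_coord //=; ring. Qed.

Lemma e3_neq0 : e_ 3 != 0 :> 'rV[K]_3.
Proof.
apply/eqP => /rowP/(_ (inord 2))/eqP.
by rewrite e_coord // mxE eqxx oner_eq0.
Qed.

Lemma wedge_eq0 u : wedge u (e_ 1) = 0 -> wedge u (e_ 2) = 0 ->
  u = u 0 (inord 2) *: e_ 3.
Proof.
rewrite /wedge !e_coord //= mulr0 mulr1 sub0r mulr0 mulr1 subr0 => /eqP.
by rewrite oppr_eq0 => /eqP u1 u0; rewrite {1}(e_sum u) u0 u1 !scale0r !add0r.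
Qed.

(** Cramer's rule in the plane K^3 / e_3. *)
Lemma wedge_cramer u v w : exists c,
  wedge u v *: w = wedge w v *: u + wedge u w *: v + c *: e_ 3.
Proof.
set d := wedge u v *: w - (wedge w v *: u + wedge u w *: v).
have dE : d = d 0 (inord 2) *: e_ 3.
  by apply: wedge_eq0; rewrite /d /wedge !mxE; ring.
by exists (d 0 (inord 2)); rewrite -dE /d addrC subrK.
Qed.

End Wedge.

(** * Anti-dendriform structures on As32 *)

Section AssociatedToAs32.

Variable K : fieldType.
Variable D : two_products 'rV[K]_3.
Hypothesis D_As32 : assoc_prod D =2 As32 K.

Local Notation "x >> y" := (rprod D x y) (at level 40).

Lemma lprod_wedge x y : lprod D x y = wedge x y *: e_ 3 - x >> y.
Proof. by rewrite -As32_wedge -D_As32 /assoc_prod addrC addKr. Qed.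

(** The identity (x . y) |> z = x <| (y . z) says that
    (x /\ y) (e_3 |> z) = - (y /\ z) (x |> e_3).  For z = y the right-hand side
    vanishes, so e_3 |> y = 0 as soon as some x has x /\ y != 0; such y span
    K^3.  The case x = y gives x |> e_3 = 0 in the same way.  Conversely, once
    e_3 annihilates |> and <|, so does every x . y, and the identities reduce
    to the vanishing of x |> (y |> z), (x <| y) <| z, (x |> y) <| z and
    x |> (y <| z), which the last two conditions express. *)
Lemma antidendriform_As32P :
  is_antidendriform D <->
  [/\ forall x, e_ 3 >> x = 0, forall x, x >> e_ 3 = 0,
      forall x y z, x >> (y >> z) = 0
    & forall x y z, (x >> y) >> z = wedge (x >> y) z *: e_ 3].
Proof.
split=> [[rr_Mr Mr_lM lM_ll rl]|[e3x xe3 rr rrl]]; last first.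
  have Mr x y z : assoc_prod D x y >> z = 0.
    by rewrite D_As32 As32_wedge linearZl_LR /= e3x scaler0.
  have lM x y z : lprod D x (assoc_prod D y z) = 0.
    rewrite lprod_wedge D_As32 As32_wedge linearZr_LR /= xe3.
    by rewrite wedgeZr wedge_e3r mulr0 scaler0 scale0r subrr.
  split=> x y z; rewrite ?rr ?Mr ?lM ?oppr0 //.
    rewrite !lprod_wedge wedgeDl wedgeNl wedgeZl wedge_e3l mulr0 add0r.
    by rewrite linearBl linearZl_LR /= e3x scaler0 sub0r rrl scaleNr subrr.
  rewrite !lprod_wedge linearBr linearZr_LR /= xe3 scaler0 sub0r rr oppr0.
  by rewrite rrl subrr.
have key x y z : wedge x y *: (e_ 3 >> z) = - (wedge y z *: (x >> e_ 3)).
  have := Mr_lM x y z; rewrite !D_As32 !As32_wedge => /oppr_inj.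
  rewrite linearZl_LR linearZr_LR /= lprod_wedge wedge_e3r scale0r sub0r.
  by rewrite scalerN.
have wl x y : wedge x y *: (e_ 3 >> y) = 0.
  by rewrite key wedgevv scale0r oppr0.
have wr x y : wedge x y *: (x >> e_ 3) = 0.
  by apply: oppr_inj; rewrite -key wedgevv scale0r oppr0.
have w21 : wedge (e_ 2) (e_ 1) = -1 :> K by rewrite wedgeC wedge_e1e2.
have e31 : e_ 3 >> e_ 1 = 0.
  by apply: oppr_inj; rewrite oppr0 -(wl (e_ 2) (e_ 1)) w21 scaleN1r.
have e32 : e_ 3 >> e_ 2 = 0 by rewrite -(wl (e_ 1) (e_ 2)) wedge_e1e2 scale1r.
(* e_3 pairs to 0 with every vector, so e_2 + e_3 is used in its place. *)
have e33 : e_ 3 >> e_ 3 = 0.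
  have := wl (e_ 1) (e_ 2 + e_ 3).
  by rewrite wedgeDr wedge_e3r addr0 wedge_e1e2 scale1r linearDr /= e32 add0r.
have e13 : e_ 1 >> e_ 3 = 0 by rewrite -(wr (e_ 1) (e_ 2)) wedge_e1e2 scale1r.
have e23 : e_ 2 >> e_ 3 = 0.
  by apply: oppr_inj; rewrite oppr0 -(wr (e_ 2) (e_ 1)) w21 scaleN1r.
have e3x x : e_ 3 >> x = 0.
  rewrite (e_sum x) !linearDr !linearZr_LR /= e31 e32 e33.
  by rewrite !scaler0 !addr0.
have xe3 x : x >> e_ 3 = 0.
  rewrite (e_sum x) !linearDl !linearZl_LR /= e13 e23 e33.
  by rewrite !scaler0 !addr0.
have rr x y z : x >> (y >> z) = 0.
  by rewrite rr_Mr D_As32 As32_wedge linearZl_LR /= e3x scaler0 oppr0.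
split=> // x y z.
have /eqP := rl x y z; rewrite !lprod_wedge linearBr linearZr_LR /= xe3 rr.
by rewrite scaler0 subr0 subr_eq0 => /eqP.
Qed.

Definition frame (b1 b2 b3 : 'rV[K]_3) : 'M[K]_3 :=
  \matrix_(i < 3) nth 0 [:: b1; b2; b3] i.

Lemma e_frame b1 b2 b3 k : (k < 3)%N ->
  e_ k.+1 *m frame b1 b2 b3 = nth 0 [:: b1; b2; b3] k.
Proof. by move=> k3; rewrite -rowE rowK /= inordK. Qed.

(** Pairing a linear relation between b1, b2 and b3 with b2, then with b1,
    kills its first two coefficients. *)
Lemma frame_unit b1 b2 (b3 := wedge b1 b2 *: e_ 3) :
  wedge b1 b2 != 0 -> frame b1 b2 b3 \in unitmx.
Proof.
move=> w0; rewrite -row_free_unit; apply: inj_row_free => v.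
rewrite {1}(e_sum v) !mulmxDl -!scalemxAl !e_frame //= => vM0.
have v0 : v 0 (inord 0) = 0.
  have := congr1 (fun x : 'rV[K]_3 => wedge x b2) vM0.
  rewrite /= !wedgeDl !wedgeZl wedgevv wedge_e3l !mulr0 !addr0.
  rewrite [in RHS]/wedge !mxE !mul0r subrr => /eqP.
  by rewrite mulf_eq0 (negPf w0) orbF => /eqP.
have v1 : v 0 (inord 1) = 0.
  have := congr1 (fun x : 'rV[K]_3 => wedge b1 x) vM0.
  rewrite /= !wedgeDr !wedgeZr wedgevv wedge_e3r !mulr0 !addr0 add0r.
  rewrite [in RHS]/wedge !mxE !mulr0 subrr => /eqP.
  by rewrite mulf_eq0 (negPf w0) orbF => /eqP.
move: vM0; rewrite v0 v1 !scale0r !add0r /b3 scalerA => /eqP.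
rewrite scaler_eq0 (negPf (e3_neq0 K)) orbF mulf_eq0 (negPf w0) orbF.
by move=> /eqP v2; rewrite (e_sum v) v0 v1 v2 !scale0r !addr0.
Qed.

(** Any b1, b2 with b1 /\ b2 != 0, completed by b3 = b1 . b2, satisfy the
    multiplication table of As32.  So for an isomorphism with a structure
    associated to As32 only the table of |> has to be matched. *)
Lemma frame_iso (E : two_products 'rV[K]_3) t b1 b2
    (b3 := wedge b1 b2 *: e_ 3) :
    assoc_prod E =2 As32 K -> rprod E =2 table_mul t -> wedge b1 b2 != 0 ->
    (forall i j : 'I_3, t i.+1 j.+1 *m frame b1 b2 b3 =
      nth 0 [:: b1; b2; b3] i >> nth 0 [:: b1; b2; b3] j) ->
  ad_iso D E.
Proof.
move=> E_As32 E_t w0 t_b; apply: ad_iso_sym.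
pose M := frame b1 b2 b3.
have M_unit : M \in unitmx by apply: frame_unit.
apply: (ad_iso_of_assoc (f := mulmxr M)) => [|x y|x y].
- by exists (mulmxr (invmx M)) => u; rewrite /= ?mulmxK ?mulmxKV.
- rewrite E_t; apply: table_mul_homo => i j /=.
  by rewrite !e_frame.
rewrite E_As32 D_As32; apply: table_mul_homo => i j.
rewrite As32_wedge /= !e_frame //.
case: i j => [[|[|[|i]]] ilt] [[|[|[|j]]] jlt] //=;
  rewrite ?mul0mx ?mulNmx ?e_frame //= /b3 ?wedgeZl ?wedgeZr ?wedge_e3l
    ?wedge_e3r ?wedgevv ?mulr0 ?scale0r //.
by rewrite [in RHS]wedgeC scaleNr.
Qed.

End AssociatedToAs32.

(** * The listed algebras are anti-dendriform *)

Section Listed.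

Variable K : fieldType.

Lemma AD8_antidendriform (a b : K) : is_antidendriform (AD8 a b).
Proof.
apply/(antidendriform_As32P (@AD8_assoc K a b)).
have r_e3l c x : rprod (AD8 a b) (c *: e_ 3) x = 0.
  by rewrite AD8_rprodE !coordE !e_coord //= !mulr0 !mul0r !mulr0
    !addr0 scale0r.
have r_e3r c x : rprod (AD8 a b) x (c *: e_ 3) = 0.
  by rewrite AD8_rprodE !coordE !e_coord //= !mulr0 !addr0 scale0r.
split=> [x|x|x y z|x y z].
- by rewrite -[e_ 3]scale1r r_e3l.
- by rewrite -[e_ 3]scale1r r_e3r.
- by rewrite [rprod _ y z]AD8_rprodE r_e3r.
by rewrite [rprod _ x y]AD8_rprodE r_e3l wedgeZl wedge_e3l mulr0 scale0r.
Qed.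

Lemma AD9_antidendriform (a : K) : is_antidendriform (AD9 a).
Proof.
apply/(antidendriform_As32P (@AD9_assoc K a)); split=> [x|x|x y z|x y z].
- by rewrite AD9_rprodE wedge_e3l mulr0 scale0r.
- by rewrite AD9_rprodE wedge_e3r mulr0 scale0r.
- by rewrite AD9_rprodE [rprod _ y z]AD9_rprodE wedgeZr wedge_e3r !mulr0 scale0r.
by rewrite AD9_rprodE [rprod _ x y]AD9_rprodE wedgeZl wedge_e3l !mulr0.
Qed.

Lemma AD10_antidendriform : is_antidendriform (AD10 K).
Proof.
apply/(antidendriform_As32P (@AD10_assoc K)); split=> [x|x|x y z|x y z].
- by rewrite AD10_rprodE !e_coord //= !mul0r !scale0r subrr.
- by rewrite AD10_rprodE !e_coord //= !mulr0 !scale0r subrr.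
- rewrite [rprod _ y z]AD10_rprodE AD10_rprodE !coordE.
  by rewrite !e_coord //= !mulr0 subrr !mulr0 !scale0r subrr.
rewrite [rprod _ x y]AD10_rprodE AD10_rprodE /wedge !coordE.
rewrite !e_coord //= !mulr0 mulr1 subrr subr0 !mul0r !scale0r !sub0r.
by rewrite scaleNr.
Qed.

Lemma As32_associated (D : two_products 'rV[K]_3) :
  assoc_prod D =2 As32 K -> associated_to D (As32 K).
Proof.
move=> D_As32; exists (idfun : {linear 'rV[K]_3 -> 'rV[K]_3}).
by split; first by exists id.
Qed.

End Listed.

(** * Exhaustiveness of the list *)

Section Exhaustive.

Variable K : closedFieldType.

Lemma quadratic_root (a b c : K) : a != 0 ->
  exists t, a * t ^+ 2 + b * t + c = 0.
Proof.
move=> a0; have [t tE] :=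
  solve_monicpoly (nth 0 [:: - c / a; - b / a]) (isT : 0 < 2)%N.
exists t; rewrite tE !big_ord_recl big_ord0 /= expr0 expr1.
by field.
Qed.

Variable D : two_products 'rV[K]_3.
Hypotheses (D_As32 : assoc_prod D =2 As32 K) (D_ad : is_antidendriform D).

Local Notation "x >> y" := (rprod D x y) (at level 40).

Lemma rprod_e3l x : e_ 3 >> x = 0.
Proof. by have [] := (antidendriform_As32P D_As32).1 D_ad. Qed.

Lemma rprod_e3r x : x >> e_ 3 = 0.
Proof. by have [] := (antidendriform_As32P D_As32).1 D_ad. Qed.

Lemma rprod_rr x y z : x >> (y >> z) = 0.
Proof. by have [] := (antidendriform_As32P D_As32).1 D_ad. Qed.

Lemma rprod_rl x y z : (x >> y) >> z = wedge (x >> y) z *: e_ 3.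
Proof. by have [] := (antidendriform_As32P D_As32).1 D_ad. Qed.

(** With b1 = v and b2 = v |> v, the products x |> b2 vanish and b2 |> b1 equals
    b2 . b1 = - b3, which is the table of AD10. *)
Lemma iso_AD10 v : wedge v (v >> v) != 0 -> ad_iso D (AD10 K).
Proof.
move=> w0; apply: (frame_iso D_As32 (@AD10_assoc K) (fun _ _ => erefl) w0).
case=> [[|[|[|i]]] ilt] [[|[|[|j]]] jlt] //=;
  rewrite ?mul0mx ?mulNmx ?e_frame //= ?linearZl_LR ?linearZr_LR /=
    ?rprod_e3l ?rprod_e3r ?rprod_rr ?scaler0 //.
by rewrite rprod_rl [in RHS]wedgeC scaleNr.
Qed.

(** If u = x |> y is independent of v modulo e_3, expand x and y on v and u.
    Since v |> u and u |> u vanish and u |> v lies on the line of e_3, the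
    product x |> y is modulo e_3 a multiple of v |> v; so v |> v is a nonzero
    multiple of u there. *)
Lemma wedge_square_neq0 v x y :
  wedge v (x >> y) != 0 -> wedge v (v >> v) != 0.
Proof.
set u := x >> y => vu0.
have [c xE] := wedge_cramer v u x.
have [d yE] := wedge_cramer v u y.
have uu : u >> u = 0 by rewrite rprod_rr.
have vu : v >> u = 0 by rewrite rprod_rr.
have uv : u >> v = wedge u v *: e_ 3 by rewrite rprod_rl.
have /(congr1 (wedge v)) : (wedge v u *: x) >> (wedge v u *: y)
    = wedge v u *: (wedge v u *: u).
  by rewrite linearZl_LR linearZr_LR.
rewrite xE yE !linearDl !linearDr !linearZl_LR !linearZr_LR /=.
rewrite !rprod_e3l !rprod_e3r uu vu uv !scaler0 !addr0.
rewrite !wedgeDr !wedgeZr wedge_e3r !mulr0 !addr0 => key.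
apply/eqP => v0; move/eqP: key; rewrite v0 !mulr0 eq_sym !mulf_eq0 orbb.
by rewrite (negPf vu0).
Qed.

Section ProductsOnLine.

Hypothesis D_deg : forall v, wedge v (v >> v) = 0.

Lemma rprod_line x y : exists c, x >> y = c *: e_ 3.
Proof.
exists ((x >> y) 0 (inord 2)); apply: wedge_eq0; rewrite wedgeC;
  apply/eqP; rewrite oppr_eq0; apply: contraTT isT => /wedge_square_neq0;
  by rewrite D_deg eqxx.
Qed.

Lemma iso_AD9 : (forall v, v >> v = 0) -> exists a, ad_iso D (AD9 a).
Proof.
move=> vv0; have [a e12] := rprod_line (e_ 1) (e_ 2).
have e21 : e_ 2 >> e_ 1 = - (a *: e_ 3).
  have := vv0 (e_ 1 + e_ 2).
  rewrite !(linearDl, linearDr) /= !vv0 add0r addr0 e12 => /eqP.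
  by rewrite addrC addr_eq0 => /eqP.
have w12 : wedge (e_ 1) (e_ 2) != 0 :> K by rewrite wedge_e1e2 oner_eq0.
exists a.
apply: (frame_iso D_As32 (@AD9_assoc K a) (fun _ _ => erefl) w12).
case=> [[|[|[|i]]] ilt] [[|[|[|j]]] jlt] //=;
  rewrite ?mul0mx -?scalemxAl ?e_frame //= ?wedge_e1e2 ?scale1r
    ?rprod_e3l ?rprod_e3r ?vv0 //.
by rewrite scaleNr.
Qed.

(** Scale the second vector of the frame so that v |> v is exactly b3, then
    shift it by a multiple of v, solving a quadratic equation, so that its
    square vanishes. *)
Lemma iso_AD8 v : v >> v != 0 -> exists a b, ad_iso D (AD8 a b).
Proof.
have [c vvE] := rprod_line v v; rewrite vvE => c0'.
have c0 : c != 0 by apply: contraNneq c0' => ->; rewrite scale0r.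
have [w0 w0N] : exists w, wedge v w != 0.
  have [v1|] := eqVneq (wedge v (e_ 1)) 0; last by exists (e_ 1).
  have [v2|] := eqVneq (wedge v (e_ 2)) 0; last by exists (e_ 2).
  have := vvE; rewrite (wedge_eq0 v1 v2) linearZl_LR /= rprod_e3l scaler0.
  by move=> cE; rewrite -cE eqxx in c0'.
pose w := (c / wedge v w0) *: w0.
have vw : wedge v w = c by rewrite wedgeZr divfK.
have [d wwE] := rprod_line w w.
have [a vwE] := rprod_line v w.
have [b wvE] := rprod_line w v.
have [t tE] := quadratic_root (a + b) d c0.
have [b2 [vb2 vb2E b2vE b2b2E]] : exists b2, [/\ wedge v b2 = c,
    v >> b2 = (a + t * c) *: e_ 3, b2 >> v = (b + t * c) *: e_ 3
    & b2 >> b2 = 0].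
  clearbody w; exists (w + t *: v); split.
  - by rewrite wedgeDr wedgeZr wedgevv mulr0 addr0.
  - by rewrite linearDr linearZr_LR /= vwE vvE scalerA -scalerDl.
  - by rewrite linearDl linearZl_LR /= wvE vvE scalerA -scalerDl.
  rewrite !linearDl !linearDr !linearZl_LR !linearZr_LR /= wwE wvE vwE vvE.
  rewrite !scalerA -!scalerDl -[RHS](scale0r (e_ 3)) -tE.
  by congr (_ *: _); ring.
have b20 : wedge v b2 != 0 by rewrite vb2.
exists ((a + t * c) / c), ((b + t * c) / c).
apply: (frame_iso D_As32 (@AD8_assoc K _ _) (fun _ _ => erefl) b20).
case=> [[|[|[|i]]] ilt] [[|[|[|j]]] jlt] //=;
  rewrite ?mul0mx -?scalemxAl ?e_frame //= ?linearZl_LR ?linearZr_LR /=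
    ?rprod_e3l ?rprod_e3r ?scaler0 // vb2 ?vvE ?scalerA ?divfK //.
Qed.

End ProductsOnLine.

Lemma As32_exhaustive :
  [\/ exists a b, ad_iso D (AD8 a b), exists a, ad_iso D (AD9 a)
    | ad_iso D (AD10 K)].
Proof.
have [[v /iso_AD10]|deg] := EM (exists v, wedge v (v >> v) != 0).
  by constructor 3.
have D_deg v : wedge v (v >> v) = 0.
  by apply/eqP; apply: contra_notT deg => v0; exists v.
have [[v /(iso_AD8 D_deg)]|sq0] := EM (exists v, v >> v != 0).
  by constructor 1.
constructor 2; apply: iso_AD9 => // v.
by apply/eqP; apply: contra_notT sq0 => v0; exists v.
Qed.

End Exhaustive.

(** * Irredundancy of the list *)

Section Irredundant.

Variable K : fieldType.
Implicit Types a b : K.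

(** The vectors e_2 and e_2 - (a + b) e_1 span the isotropic lines of the form
    of AD8; the isomorphism puts the second in the place of the first. *)
Lemma AD8_swap a b : ad_iso (AD8 a b) (AD8 (- b) (- a)).
Proof.
pose b2 : 'rV[K]_3 := e_ 2 + (- (a + b)) *: e_ 1.
have w1 : wedge (e_ 1) b2 = 1.
  by rewrite wedgeDr wedge_e1e2 wedgeZr wedgevv mulr0 addr0.
have w0 : wedge (e_ 1) b2 != 0 by rewrite w1 oner_eq0.
apply: (frame_iso (@AD8_assoc K a b) (@AD8_assoc K _ _) (fun _ _ => erefl) w0).
case=> [[|[|[|i]]] ilt] [[|[|[|j]]] jlt] //=;
  rewrite ?mul0mx -?scalemxAl ?e_frame //= ?w1 ?scale1r AD8_rprodE ?coordE
    !e_coord //=;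
  by apply/rowP => k; move: (e_ 3) => e; rewrite !mxE; ring.
Qed.

(** Comparing the forms of the two algebras along the isomorphism, their
    antisymmetric parts give a' - b' = a - b and their determinants give
    a' * b' = a * b, whence (b' - b) * (b' + a) = 0. *)
Lemma AD8_iso_params a b a' b' : ad_iso (AD8 a b) (AD8 a' b') ->
  (a', b') = (a, b) \/ (a', b') = (- b, - a).
Proof.
case=> f [/bij_inj f_inj f_r f_l].
have f_m := ad_iso_assoc f_r f_l.
set P := f (e_ 1); set Q := f (e_ 2).
have fe3 : f (e_ 3) = wedge P Q *: e_ 3.
  have := f_m (e_ 1) (e_ 2); rewrite !AD8_assoc !As32_wedge wedge_e1e2 scale1r.
  by [].
have d0 : wedge P Q != 0.
  apply/eqP => w0; move: fe3; rewrite w0 scale0r -(linear0 f) => /f_inj e30.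
  by have := e3_neq0 K; rewrite e30 eqxx.
have e3I (x y : K) : x *: (e_ 3 : 'rV[K]_3) = y *: e_ 3 -> x = y.
  move/eqP; rewrite -subr_eq0 -scalerBl scaler_eq0 (negPf (e3_neq0 K)) orbF.
  by rewrite subr_eq0 => /eqP.
have f11 := f_r (e_ 1) (e_ 1); have f12 := f_r (e_ 1) (e_ 2).
have f21 := f_r (e_ 2) (e_ 1); have f22 := f_r (e_ 2) (e_ 2).
move: f11 f12 f21 f22; rewrite -/P -/Q !AD8_rprodE !e_coord //= !linearZ /= fe3.
rewrite !scalerA => /e3I f11 /e3I f12 /e3I f21 /e3I f22.
move: d0 f11 f12 f21 f22; rewrite /wedge.
move: (P 0 _) (P 0 _) (Q 0 _) (Q 0 _) => p q r s d0 f11 f12 f21 f22.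
have diff : a' - b' = a - b.
  apply/esym/(mulIf d0).
  by apply: etrans (etrans (congr2 (fun x y => x - y) f12 f21) _) => /=; ring.
have prod : a' * b' = a * b.
  apply/esym/(mulIf d0)/(mulIf d0)/oppr_inj.
  have det := congr2 (fun x y => x - y) (congr2 *%R f11 f22)
    (congr2 *%R f12 f21).
  by apply: etrans (etrans det _) => /=; ring.
have a'E : a' = a - b + b' by rewrite -diff subrK.
have /eqP : (b' - b) * (b' + a) = 0
  by rewrite -(subrr (a * b)) -[in X in _ = X - _]prod a'E; ring.
rewrite mulf_eq0 subr_eq0 addr_eq0 => /orP[]/eqP b'E; [left|right].
  by rewrite a'E b'E subrK.
by rewrite a'E b'E; congr (_, _); ring.
Qed.

Lemma AD9_iso_param a a' : ad_iso (AD9 a) (AD9 a') -> a = a'.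
Proof.
case=> f [/bij_inj f_inj f_r f_l].
have f_m := ad_iso_assoc f_r f_l.
have E (c : K) x y : rprod (AD9 c) x y = c *: assoc_prod (AD9 c) x y.
  by rewrite AD9_rprodE AD9_assoc As32_wedge scalerA.
have := f_r (e_ 1) (e_ 2); rewrite !E linearZ /= f_m !AD9_assoc => /eqP.
rewrite -subr_eq0 -scalerBl scaler_eq0 subr_eq0 => /orP[/eqP //|].
rewrite -(AD9_assoc a') -f_m AD9_assoc As32_wedge wedge_e1e2 scale1r.
by rewrite -[X in _ == X](linear0 f) (inj_eq f_inj) (negPf (e3_neq0 K)).
Qed.

Lemma AD9_square a x : rprod (AD9 a) x x = 0.
Proof. by rewrite AD9_rprodE wedgevv mulr0 scale0r. Qed.

Lemma not_iso_AD9 (D : two_products 'rV[K]_3) x a :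
  rprod D x x != 0 -> ~ ad_iso D (AD9 a).
Proof.
move=> xx0 [f [/bij_inj f_inj f_r _]]; case/eqP: xx0; apply: f_inj.
by rewrite f_r AD9_square linear0.
Qed.

Lemma AD8_square_neq0 a b : rprod (AD8 a b) (e_ 1) (e_ 1) != 0.
Proof.
rewrite AD8_rprodE !e_coord //= !(mulr1, mulr0, addr0) scale1r.
exact: e3_neq0.
Qed.

Lemma AD10_square : rprod (AD10 K) (e_ 1) (e_ 1) = e_ 2.
Proof.
by rewrite AD10_rprodE !e_coord //= mulr1 mul0r scale1r scale0r subr0.
Qed.

Lemma AD10_cube : rprod (AD10 K) (rprod (AD10 K) (e_ 1) (e_ 1)) (e_ 1) = - e_ 3.
Proof.
rewrite AD10_square AD10_rprodE !e_coord //= !mulr1 scale1r scale0r.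
by rewrite sub0r.
Qed.

Lemma AD8_not_AD10 a b : ~ ad_iso (AD8 a b) (AD10 K).
Proof.
move/ad_iso_sym=> [f [/bij_inj f_inj f_r _]].
have := e3_neq0 K; rewrite -oppr_eq0 -AD10_cube -(inj_eq f_inj) linear0 !f_r.
by rewrite AD8_rprodE AD8_rprodE !coordE !e_coord //= !(mulr0, mul0r) !addr0
  scale0r eqxx.
Qed.

Lemma AD9_not_AD10 a : ~ ad_iso (AD9 a) (AD10 K).
Proof.
move/ad_iso_sym; apply: (@not_iso_AD9 _ (e_ 1)); rewrite AD10_square.
apply: contraTneq (oner_neq0 K) => e20.
by rewrite -wedge_e1e2 e20 /wedge !mxE !mulr0 subrr eqxx.
Qed.

End Irredundant.

Theorem theorem4p2 (R : realType) :
  (* the listed algebras are anti-dendriform and associated to As32 *)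
  [/\ forall alpha beta : R[i],
        is_antidendriform (AD8 alpha beta)
        /\ associated_to (AD8 alpha beta) (As32 R[i]),
      forall alpha : R[i],
        is_antidendriform (AD9 alpha)
        /\ associated_to (AD9 alpha) (As32 R[i])
    & is_antidendriform (AD10 R[i])
        /\ associated_to (AD10 R[i]) (As32 R[i])] /\
  (* the list is exhaustive *)
  (forall (A : vectType R[i]) (D : two_products A),
     \dim {:A} = 3%N -> is_antidendriform D -> associated_to D (As32 R[i]) ->
     [\/ exists alpha beta : R[i], ad_iso D (AD8 alpha beta),
         exists alpha : R[i], ad_iso D (AD9 alpha)
       | ad_iso D (AD10 R[i])]) /\
  (* the list is irredundant, apart from AD8 (a, b) ~ AD8 (- b, - a) *)
  [/\ forall alpha beta alpha' beta' : R[i],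
        ad_iso (AD8 alpha beta) (AD8 alpha' beta') <->
        (alpha', beta') = (alpha, beta) \/
        (alpha', beta') = (- beta, - alpha),
      forall alpha alpha' : R[i],
        ad_iso (AD9 alpha) (AD9 alpha') -> alpha = alpha',
      forall alpha beta gamma : R[i],
        ~ ad_iso (AD8 alpha beta) (AD9 gamma),
      forall alpha beta : R[i],
        ~ ad_iso (AD8 alpha beta) (AD10 R[i])
    & forall alpha : R[i],
        ~ ad_iso (AD9 alpha) (AD10 R[i])].
Proof.
split; [split=> [a b|a|]|split=> [A D _ D_ad D_As32|]].
- split; first exact: AD8_antidendriform.
  exact/As32_associated/AD8_assoc.
- split; first exact: AD9_antidendriform.
  exact/As32_associated/AD9_assoc.
- split; first exact: AD10_antidendriform.
  exact/As32_associated/AD10_assoc.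
- have [E isoDE E_As32] := associated_to_transport D_As32.
  have E_ad := ad_iso_antidendriform isoDE D_ad.
  have [[a [b]]|[a]|] := As32_exhaustive E_As32 E_ad => /(ad_iso_trans isoDE).
  + by constructor 1; exists a, b.
  + by constructor 2; exists a.
  + by constructor 3.
split=> [a b a' b'|a a'|a b c|a b|a].
- split=> [|[[-> ->]|[-> ->]]]; [exact: AD8_iso_params | | exact: AD8_swap].
  by exists (idfun : {linear 'rV[R[i]]_3 -> 'rV[R[i]]_3}); split=> //; exists id.
- exact: AD9_iso_param.
- exact/not_iso_AD9/AD8_square_neq0.
- exact: AD8_not_AD10.
- exact: AD9_not_AD10.
Qed.
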